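(* Let $G$ be a group. Then $G$ is finite-by-nilpotent if and only if there exist positive integers $m,n$ such that $|x^{X_n(G)}|\le m$ for every $x\in G$.
   Context: A group $G$ is finite-by-nilpotent if it has a finite normal subgroup $N$ such that $G/N$ is nilpotent. Commutators are $[a,b]=a^{-1}b^{-1}ab$, and longer commutators are left-normed: $[x_1,\dots,x_n]=[[x_1,\dots,x_{n-1}],x_n]$, with $[x_1]=x_1$. $X_n(G)=\{[g_1,\dots,g_n]\mid g_1,\dots,g_n\in G\}$ is the set of $\gamma_n$-values in $G$ (so $X_1(G)=G$); it is a set, not a subgroup in general. For $x\in G$ and a subset $S\subseteq G$, $x^S=\{x^s\mid s\in S\}$, where $x^s=s^{-1}xs$. *)

(* Defs.v *)
From HB Require Import structures.
From mathcomp Require Import all_boot.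
From mathcomp Require Import boolp classical_sets cardinality.

Set Implicit Arguments.
Unset Strict Implicit.
Unset Printing Implicit Defensive.

Local Open Scope classical_set_scope.
Local Open Scope quotient_scope.
Local Open Scope group_scope.

Record normal_subgroup (G : groupType) := NormalSubgroup {
  normal_set :> set G;
  normal_set_group : group_closed [in normal_set];
  normal_setJ : forall x y, normal_set x -> normal_set (x ^ y)
}.

Section Quotient.
Context (G : groupType) (N : normal_subgroup G).

Lemma normal_set1 : normal_set N 1.
Proof. by have [/set_mem] := normal_set_group N. Qed.

Lemma normal_setF x y : normal_set N x -> normal_set N y -> normal_set N (x / y).
Proof.
have [_ NF] := normal_set_group N.
by move=> /mem_set Nx /mem_set Ny; apply/set_mem/NF.
Qed.

Lemma normal_setV x : normal_set N x -> normal_set N x^-1.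
Proof. by move=> Nx; rewrite -[x^-1]mul1g; apply: normal_setF normal_set1 Nx. Qed.

Lemma normal_setM x y : normal_set N x -> normal_set N y -> normal_set N (x * y).
Proof. by move=> Nx /normal_setV Ny; rewrite -[y]invgK; apply: normal_setF. Qed.

Definition eq_mod : rel G := fun x y => `[< normal_set N (x^-1 * y) >].

Lemma eq_mod_refl : reflexive eq_mod.
Proof. by move=> x; apply/asboolP; rewrite mulVg; apply: normal_set1. Qed.

Lemma eq_mod_sym : symmetric eq_mod.
Proof.
by move=> x y; apply/asboolP/asboolP => /normal_setV; rewrite invgM invgK.
Qed.

Lemma eq_mod_trans : transitive eq_mod.
Proof.
move=> y x z /asboolP Nxy /asboolP Nyz; apply/asboolP.
by move: (normal_setM Nxy Nyz); rewrite mulgA mulgK.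
Qed.

Canonical eq_mod_equiv := EquivRel eq_mod eq_mod_refl eq_mod_sym eq_mod_trans.

Definition quotient_group := {eq_quot eq_mod}.

HB.instance Definition _ := Choice.on quotient_group.
HB.instance Definition _ : EqQuotient G eq_mod quotient_group :=
  EqQuotient.on quotient_group.

Definition quotient_one : quotient_group := lift_cst quotient_group 1.
Definition quotient_mul := lift_op2 quotient_group *%g.
Definition quotient_inv := lift_op1 quotient_group (@inv G).

Lemma eq_quotientP (x y : G) :
  \pi_(quotient_group) x = \pi_(quotient_group) y <-> normal_set N (x^-1 * y).
Proof. by split=> [/eqmodP/asboolP|Nxy] //; apply/eqmodP/asboolP. Qed.

Lemma repr_mod (x : G) : normal_set N (x^-1 * repr (\pi_(quotient_group) x)).
Proof. by apply/eq_quotientP; rewrite reprK. Qed.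

Lemma pi_quotient_mul :
  {morph \pi_(quotient_group) : x y / x * y >-> quotient_mul x y}.
Proof.
move=> x y; unlock quotient_mul; apply/eq_quotientP.
set x' := repr _; set y' := repr _.
have -> : (x * y)^-1 * (x' * y') = (x^-1 * x') ^ y * (y^-1 * y').
  by rewrite invgM conjgE !mulgA mulgK.
by apply: normal_setM; [apply: normal_setJ|]; apply: repr_mod.
Qed.

Lemma pi_quotient_inv :
  {morph \pi_(quotient_group) : x / x^-1 >-> quotient_inv x}.
Proof.
move=> x; unlock quotient_inv; apply/eq_quotientP; set x' := repr _.
have -> : (x^-1)^-1 * x'^-1 = ((x^-1 * x')^-1) ^ x^-1.
  by rewrite invgM conjgE !invgK !mulgA mulgK.
by apply/normal_setJ/normal_setV/repr_mod.
Qed.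

Canonical pi_quotient_one_morph := PiConst quotient_one.
Canonical pi_quotient_mul_morph := PiMorph2 pi_quotient_mul.
Canonical pi_quotient_inv_morph := PiMorph1 pi_quotient_inv.

Lemma quotient_mulA : associative quotient_mul.
Proof.
by move=> a b c; rewrite -[a]reprK -[b]reprK -[c]reprK !piE mulgA.
Qed.

Lemma quotient_mul1 : left_id quotient_one quotient_mul.
Proof. by move=> a; rewrite -[a]reprK !piE mul1g. Qed.

Lemma quotient_mulr1 : right_id quotient_one quotient_mul.
Proof. by move=> a; rewrite -[a]reprK !piE mulg1. Qed.

Lemma quotient_mulV : left_inverse quotient_one quotient_inv quotient_mul.
Proof. by move=> a; rewrite -[a]reprK !piE mulVg. Qed.

Lemma quotient_mulrV : right_inverse quotient_one quotient_inv quotient_mul.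
Proof. by move=> a; rewrite -[a]reprK !piE mulgV. Qed.

HB.instance Definition _ := isGroup.Build quotient_group
  quotient_mulA quotient_mul1 quotient_mulr1 quotient_mulV quotient_mulrV.

Lemma pi_quotient1 : \pi_(quotient_group) 1 = 1.
Proof. by rewrite -[RHS]/quotient_one !piE. Qed.

Lemma pi_quotientM : {morph \pi_(quotient_group) : x y / x * y >-> x * y}.
Proof. exact: pi_quotient_mul. Qed.

Lemma pi_quotientV : {morph \pi_(quotient_group) : x / x^-1 >-> x^-1}.
Proof. exact: pi_quotient_inv. Qed.

End Quotient.

Definition generated (G : groupType) (S : set G) : set G :=
  smallest (fun H : set G => group_closed [in H]) S.

Definition commutator_subgroup (G : groupType) (A B : set G) : set G :=
  generated [set [~ x, y] | x in A & y in B].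

(* Indexed from 0, so that [lower_central G i] is gamma_(i+1)(G). *)
Definition lower_central (G : groupType) (i : nat) : set G :=
  iter i (fun H => commutator_subgroup H [set: G]) [set: G].
Arguments lower_central : clear implicits.

Definition nilpotent (G : groupType) : Prop :=
  exists c, lower_central G c = [set 1].

Definition finite_by_nilpotent (G : groupType) : Prop :=
  exists N : normal_subgroup G, finite_set N /\ nilpotent (quotient_group N).

(* [left_normed [:: x1; ...; xn]] is the commutator [x1, ..., xn]; the value 1 on
   the empty sequence is a dummy. *)
Definition left_normed (G : groupType) (s : seq G) : G :=
  if s is x :: s' then foldl commg x s' else 1.

Definition gamma_values (G : groupType) (n : nat) : set G :=
  [set left_normed t | t in [set: n.-tuple G]].
Arguments gamma_values : clear implicits.

Definition conj_set (G : groupType) (x : G) (S : set G) : set G :=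
  [set x ^ s | s in S].

(* Main.v *)
(* Write X_i for the set of gamma_i-values. Conversely to the easy direction,
   let |x^(X_n)| <= m for all x. Neumann's extremal argument bounds commutator
   sets: if every y in Y has finitely many S-conjugates, then only finitely many
   commutators [s, y] with s in S and y in Y exist. With S = Y = X_n the
   set of [h, h'] with h, h' in X_n is finite, and a double induction on weights
   then shows that z^(X_j) is finite for z in X_(2n-j), for j = n, ..., 1. So the
   elements of X_(2n-1) have finite conjugacy classes, and the extremal argument
   with S = G and Y = X_(2n-1) makes X_(2n) finite. Finally gamma_k(G) is finite
   as soon as X_k is (conciseness of lower central words). *)
Require Import Defs.
From mathcomp Require Import all_boot zify.
From mathcomp Require Import boolp classical_sets functions cardinality.

Local Open Scope classical_set_scope.
Local Open Scope card_scope.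

Set Implicit Arguments.
Unset Strict Implicit.
Unset Printing Implicit Defensive.
Local Open Scope group_scope.

Ltac free_group :=
  rewrite /commg /conjg;
  repeat progress rewrite ?invgM ?invgK ?invg1 ?mulg1 ?mul1g -?mulgA
    ?mulKg ?mulVKg ?mulVg ?mulgV; try done.

(** * Closure properties of the sets of gamma values *)

Section GammaValues.
Context {G : groupType}.
Implicit Types (x y g t : G) (n : nat).
Local Notation X := (gamma_values G).

Lemma gamma_values1 : X 1 = [set: G].
Proof. by apply/seteqP; split=> x //= _; exists [tuple x]. Qed.

Lemma gamma_valuesS n :
  X n.+2 = [set [~ x, t] | x in X n.+1 & t in [set: G]].
Proof.
have E u t : u != [::] -> left_normed (rcons u t) = [~ left_normed u, t].
  by case: u => //= x u _; rewrite foldl_rcons.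
apply/seteqP; split=> [_ [[s ss] _ <-]|_ [_ [u _ <-] [t _ <-]]] /=.
  case: (lastP s) ss => // u t; rewrite size_rcons eqSS => su.
  exists (left_normed u); first by exists (Tuple su).
  by exists t => //; rewrite E // -size_eq0 (eqP su).
exists [tuple of rcons u t] => //=.
by rewrite E // -size_eq0 size_tuple.
Qed.

Lemma gamma_values_commg n x t : X n.+1 x -> X n.+2 [~ x, t].
Proof. by move=> Xx; rewrite gamma_valuesS; exists x => //; exists t. Qed.

Lemma gamma_values_foldl n x s : X n.+1 x -> X (n + size s).+1 (foldl commg x s).
Proof.
elim: s n x => [|t s IH] n x Xx /=; first by rewrite addn0.
by rewrite addnS -addSn; apply/IH/gamma_values_commg.
Qed.

Lemma gamma_valuesJ n x g : X n.+1 x -> X n.+1 (x ^ g).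
Proof.
elim: n x => [|n IH] x; first by rewrite gamma_values1.
rewrite {1}gamma_valuesS => -[y Xy [t _ <-]].
by rewrite conjRg; apply/gamma_values_commg/IH.
Qed.

Lemma gamma_valuesV n x : X n.+1 x -> X n.+1 x^-1.
Proof.
elim: n x => [|n IH] x; first by rewrite gamma_values1.
rewrite {1}gamma_valuesS => -[y Xy [t _ <-]].
have -> : [~ y, t]^-1 = [~ y^-1, t ^ y] by free_group.
exact/gamma_values_commg/IH.
Qed.

Lemma gamma_values_commgr n x t : X n.+1 x -> X n.+2 [~ t, x].
Proof.
by move=> Xx; rewrite -invgR; apply/gamma_valuesV/gamma_values_commg.
Qed.

(** The first d + 1 entries of a longer commutator are taken together as one entry. *)
Lemma gamma_values_antimono n d : X (n + d).+1 `<=` X n.+1.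
Proof.
elim: n => [|n IH] x; first by rewrite gamma_values1.
rewrite addSn gamma_valuesS => -[y /IH Xy [t _ <-]].
exact: gamma_values_commg.
Qed.

Lemma gamma_value_one n : X n.+1 1.
Proof.
elim: n => [|n IH]; first by rewrite gamma_values1.
by rewrite -(commg1 1); apply: gamma_values_commg.
Qed.

End GammaValues.

(** * Finiteness of sets of commutators *)

Lemma card_ge_uniq (T : eqType) (A : set T) (s : seq T) :
  uniq s -> (forall x, x \in s -> A x) -> `I_(size s) #<= A.
Proof.
move=> us sA; case: s us sA => [|x0 s] us sA; first by rewrite II0 card_ge0.
have /injfunPex[f] : exists2 f, set_fun `I_(size (x0 :: s)) A f &
    set_inj `I_(size (x0 :: s)) f; last exact: inj_card_le f.
exists (nth x0 (x0 :: s)).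
  by move=> i /= si; apply/sA/mem_nth.
by move=> i j /set_mem /= si /set_mem /= sj /eqP; rewrite nth_uniq // => /eqP.
Qed.

Section FiniteCommutators.
Context {G : groupType}.

Lemma finite_transversal (T : Type) (f : G -> T) (S : set G) :
  finite_set (f @` S) ->
  exists B, [/\ finite_set B, B `<=` S &
    forall s, S s -> exists2 b, B b & f b = f s].
Proof.
move=> fin; pose g v := xget 1 [set s | S s /\ f s = v].
have gP s : S s -> S (g (f s)) /\ f (g (f s)) = f s.
  by move=> Ss; apply: (xgetPex 1 (P := [set u | S u /\ f u = f s])); exists s.
exists (g @` (f @` S)); split; first exact: finite_image.
  by move=> _ [_ [s Ss <-] <-]; have [] := gP s Ss.
by move=> s Ss; exists (g (f s)); [exists (f s) => //; exists s | have [] := gP s Ss].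
Qed.

(** Elements of S with the same image lie in one coset of the centraliser of [ys], so S meets only
    finitely many such cosets. *)
Lemma finite_seq_map (S : set G) (ys : seq G) :
  (forall y, y \in ys -> finite_set (conj_set y S)) ->
  finite_set [set [seq y ^ s | y <- ys] | s in S].
Proof.
elim: ys => [|y ys IH] fin.
  by apply: sub_finite_set (finite_set1 [::]) => _ [s _ <-].
have finy : finite_set (conj_set y S) by apply: fin; rewrite mem_head.
have /IH finys : forall z, z \in ys -> finite_set (conj_set z S).
  by move=> z zys; apply: fin; rewrite inE zys orbT.
apply: sub_finite_set (finite_image2 cons finy finys) => _ [s Ss <-].
by exists (y ^ s); [exists s | exists [seq z ^ s | z <- ys] => //; exists s].
Qed.

(* Neumann's extremal argument: if a has the largest orbit a^Y, represented by
   ys, and u centralises ys, then the orbit of u * a is u * a^Y, so that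
   [u, y] lies in a^Y (a^Y)^-1 for all y in Y. *)
Lemma finite_commutators m (S Y : set G) :
  (forall a, conj_set a Y #<= `I_m) ->
  (forall y, Y y -> finite_set (conj_set y S)) ->
  finite_set [set [~ s, y] | s in S & y in Y].
Proof.
move=> boundY finS.
pose P r := `[< exists (a : G) (ys : seq G), [/\ size ys = r,
  forall y, y \in ys -> Y y & uniq [seq a ^ y | y <- ys]] >].
have P0 : exists r, P r by exists 0%N; apply/asboolP; exists 1, [::].
(* The bound m, uniform in a, is what makes a longest list of distinct conjugates [a ^ y] exist. *)
have Pm r : P r -> r <= m.
  move=> /asboolP[a [ys [<- Yys uys]]].
  rewrite -card_le_II -(size_map (fun y => a ^ y)).
  apply: card_le_trans (boundY a); apply: card_ge_uniq uys _.
  by move=> _ /mapP[y /Yys Yy ->]; exists y.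
case: (ex_maxnP P0 Pm) => r /asboolP[a [ys [sys Yys uys]]] rmax.
have orbit b y : uniq [seq b ^ z | z <- ys] -> Y y ->
    exists2 z, z \in ys & b ^ y = b ^ z.
  move=> uz Yy; apply/mapP; apply: contrapT => /negP nin.
  suff /rmax : P r.+1 by rewrite ltnn.
  apply/asboolP; exists b, (y :: ys); split; rewrite /= ?sys ?nin //.
  by move=> z /predU1P[->|/Yys].
pose l := [seq a ^ y | y <- ys].
have comm u y : {in ys, forall z, z ^ u = z} -> Y y ->
    [set` [seq p * q^-1 | p <- l, q <- l]] [~ u, y].
  move=> cu Yy.
  have uz z : z \in ys -> (u * a) ^ z = u * a ^ z.
    by move=> /cu /conjg_fixP; rewrite commg1_sym conjMg => /conjg_fixP ->.
  have [|z zys eqz] := orbit (u * a) y _ Yy.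
    have -> : [seq (u * a) ^ z | z <- ys] = [seq u * x | x <- l].
      by rewrite -map_comp; apply/eq_in_map.
    by rewrite map_inj_uniq //; apply: mulgI.
  have [z' z'ys eqz'] := orbit a y uys Yy.
  apply/allpairsP; exists (a ^ z, a ^ z'); split; [exact: map_f | exact: map_f |].
  rewrite /= -eqz'; move: eqz; rewrite (uz z zys) conjMg commgEl => /(canRL (mulgK _)) ->.
  by free_group.
have [B [finB BS transB]] := finite_transversal
  (finite_seq_map (fun y yys => finS y (Yys y yys))).
have finbY b : finite_set [set [~ b, y] | y in Y].
  have := finite_image (fun x => b^-1 * x)
    (card_le_finite (boundY b) (finite_II m)).
  by apply: sub_finite_set => _ [y Yy <-]; exists (b ^ y) => //; exists y.
(* Write s = u b with b in the transversal B and u centralising [ys]. Then [s, y] = [u, y]^b [b, y],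
   and for each b both factors range over finite sets. *)
have := bigcup_finite finB (fun b _ => finite_image2 (fun d c => d ^ b * c)
  (finite_seq [seq p * q^-1 | p <- l, q <- l]) (finbY b)).
apply: sub_finite_set => _ [s Ss [y Yy <-]].
have [b Bb /eq_in_map eqb] := transB s Ss; exists b => //.
exists [~ s * b^-1, y].
  by apply: comm => // z zys; rewrite conjgM -eqb // conjgK.
by exists [~ b, y]; [exists y | free_group].
Qed.

End FiniteCommutators.

(** * Finite conjugation orbits by induction on weights *)

Section FiniteConjugates.
Context {G : groupType} (n : nat).
Local Notation X := (gamma_values G).
Hypothesis fin_conj : forall a : G, finite_set (conj_set a (X n.+1)).
Hypothesis fin_comm :
  finite_set [set [~ h, h'] | h in X n.+1 & h' in X n.+1].

Let fin_commr k : finite_set [set [~ h, k] | h in X n.+1].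
Proof.
apply: sub_finite_set (finite_image (fun x => x * k) (fin_conj k^-1)).
by move=> _ [h Xh <-]; exists (k^-1 ^ h); [exists h | rewrite commgEr].
Qed.

(* With k' = k g k^-1 g^-1 one has [z, k]^g = [z^g, k] ([z, k']^g)^k, where k'
   is a gamma_value of weight larger than those of both k and g. *)
Lemma finite_conj_commg (j d : nat) :
  (forall z, X (n + d).+1 z -> finite_set (conj_set z (X j.+2))) ->
  forall e i z k, (i + e)%N = n -> X (n + d).+1 z -> X i.+1 k ->
  finite_set (conj_set [~ z, k] (X j.+1)).
Proof.
move=> finz; elim=> [|e IH] i z k ien Xz Xk.
  (* Here i = n, so z and k, with all their conjugates, are gamma values of weight n + 1. *)
  apply: sub_finite_set fin_comm => _ [g _ <-].
  exists (z ^ g); first exact/gamma_valuesJ/(gamma_values_antimono Xz).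
  exists (k ^ g); last by rewrite conjRg.
  by apply: gamma_valuesJ; rewrite -ien addn0.
(* There are finitely many [z, k'] because k' has weight j + 2; each has a finite orbit by induction
   because k' also has weight i + 2. *)
pose C := [set [~ z, k'] | k' in X i.+2 `&` X j.+2].
have finC : finite_set C.
  apply: sub_finite_set (finite_image (fun x => z^-1 * x) (finz z Xz)).
  by move=> _ [k' [_ Xk'] <-]; exists (z ^ k') => //; exists k'.
have finF : finite_set (\bigcup_(c in C) conj_set c (X j.+1)).
  apply: bigcup_finite finC _ => _ [k' [Xk' _] <-].
  by apply: (IH i.+1) => //; rewrite addSnnS.
apply: sub_finite_set (finite_image2 (fun a b => a * b ^ k) (fin_commr k) finF).
move=> _ [g Xg <-].
exists [~ z ^ g, k].
  by exists (z ^ g) => //; exact/gamma_valuesJ/(gamma_values_antimono Xz).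
exists ([~ z, [~ k^-1, g^-1]] ^ g); last by free_group.
exists [~ z, [~ k^-1, g^-1]]; last by exists g.
exists [~ k^-1, g^-1] => //; split.
  exact/gamma_values_commg/gamma_valuesV.
exact/gamma_values_commgr/gamma_valuesV.
Qed.

(** Downward induction on j = n - d: the weights of z and of the conjugating elements add up to 2(n
    + 1). In the step z = [y, t] with t of weight 1, whence i = 0 and e = n. *)
Lemma finite_conj_gamma (d j : nat) (z : G) :
  (j + d)%N = n -> X (n + d).+1 z -> finite_set (conj_set z (X j.+1)).
Proof.
elim: d j z => [|d IH] j z jdn Xz.
  by move: jdn; rewrite addn0 => ->; apply: fin_conj.
move: Xz; rewrite addnS gamma_valuesS => -[y Xy [t _ <-]].
apply: (@finite_conj_commg j d _ n 0%N) => // [x|]; last by rewrite gamma_values1.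
by apply: IH; rewrite addSnnS.
Qed.

End FiniteConjugates.

(** * Generated subgroups *)

Lemma generated_sub (G : groupType) (S H : set G) :
  group_closed [in H] -> S `<=` H -> generated S `<=` H.
Proof. by move=> gH SH x; apply. Qed.

Lemma sub_generated (G : groupType) (S : set G) : S `<=` generated S.
Proof. by move=> x Sx H [_]; apply. Qed.

Lemma group_closedP (G : groupType) (H : set G) :
  H 1 -> (forall x y, H x -> H y -> H (x * y^-1)) -> group_closed [in H].
Proof.
move=> H1 HF; split; first exact: mem_set.
by move=> x y /set_mem Hx /set_mem Hy; apply/mem_set/HF.
Qed.

Lemma generated_group (G : groupType) (S : set G) :
  group_closed [in generated S].
Proof.
apply: group_closedP => [H [[/set_mem]]|x y Sx Sy H HS] //.
have /mem_set Hx := Sx H HS; have /mem_set Hy := Sy H HS.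
by have [[_ HF] _] := HS; apply/set_mem/HF.
Qed.

Lemma generatedX (G : groupType) (S : set G) x e :
  generated S x -> generated S (x ^+ e).
Proof.
move=> Sx; elim: e => [|e IH]; first by have [/set_mem] := generated_group S.
rewrite expgS; apply/set_mem/(group_closedM (generated_group S)); exact/mem_set.
Qed.

Lemma generatedJ (G : groupType) (S : set G) x g :
  (forall y, S y -> S (y ^ g)) -> generated S x -> generated S (x ^ g).
Proof.
move=> SJ; pose H := [set y | generated S (y ^ g)].
have [/set_mem S1 SF] := generated_group S.
suff : generated S `<=` H by apply.
apply: generated_sub => [|y Sy]; last by apply: sub_generated; apply: SJ.
apply: group_closedP => [|y z Hy Hz]; first by rewrite /H /= conj1g.
by rewrite /H /= conjMg conjVg; apply/set_mem/SF; apply/mem_set.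
Qed.

Lemma generated_prod (G : groupType) (S : set G) x :
  (forall y, S y -> S y^-1) -> generated S x ->
  exists2 s : seq G, (forall y, y \in s -> S y) & x = \prod_(y <- s) y.
Proof.
move=> SV; pose P := [set x | exists2 s : seq G,
  (forall y, y \in s -> S y) & x = \prod_(y <- s) y].
suff : generated S `<=` P by apply.
apply: generated_sub => [|y Sy]; last first.
  by exists [:: y]; rewrite ?big_seq1 // => z; rewrite inE => /eqP ->.
apply: group_closedP => [|_ _ [s Ss ->] [t St ->]].
  by exists [::]; rewrite ?big_nil.
exists (s ++ rev [seq y^-1 | y <- t]).
  move=> y; rewrite mem_cat mem_rev => /orP[/Ss //|/mapP[z /St Sz ->]].
  exact: SV.
rewrite big_cat /=; congr (_ * _).
elim: t {St} => [|y t IH]; first by rewrite !big_nil invg1.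
by rewrite /= rev_cons -cats1 big_cat big_cons big_seq1 invgM IH.
Qed.

(** * Pigeonhole and collection arguments *)

Lemma repetition (T : eqType) (s : seq T) (f : nat -> T) :
  (forall i, f i \in s) -> exists i j, [/\ i < j, j <= size s & f i = f j].
Proof.
move=> fs; apply: contrapT => nrep.
suff u : uniq (mkseq f (size s).+1).
  have /(uniq_leq_size u) : {subset mkseq f (size s).+1 <= s}.
    by move=> _ /mapP[i _ ->].
  by rewrite size_mkseq ltnn.
rewrite map_inj_in_uniq ?iota_uniq // => i j.
rewrite !mem_iota !add0n /= !ltnS => ile jle fij.
case: (ltngtP i j) => // ltij; case: nrep.
  by exists i, j.
by exists j, i.
Qed.

(** Two of the first |s| + 1 values of f agree, at indices whose difference d is at most |s|. Then
    x^d lies in H and d divides |s|!, an exponent that depends on |s| alone. *)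
Lemma expg_fact_closed (G : groupType) (T : eqType) (H : set G) (x : G)
    (s : seq T) (f : nat -> T) :
  H 1 -> (forall a b, H a -> H b -> H (a * b)) -> (forall i, f i \in s) ->
  (forall i d, f i = f (i + d)%N -> H (x ^+ d)) -> H (x ^+ (size s)`!).
Proof.
move=> H1 HM fs fH; have [i [j [ij js fij]]] := repetition fs.
have Hd : H (x ^+ (j - i)) by apply: (fH i); rewrite subnKC // ltnW.
have /dvdnP[q ->] : (j - i) %| (size s)`!.
  by apply: dvdn_fact; rewrite subn_gt0 ij (leq_trans (leq_subr _ _) js).
rewrite mulnC expgnA; elim: q => [|q IH] //.
by rewrite expgS; apply: HM.
Qed.

Lemma size_le_count (T : eqType) (e : nat) (xs s : seq T) :
  {subset s <= xs} -> (forall x, x \in xs -> count_mem x s <= e) ->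
  size s <= size xs * e.
Proof.
elim: xs s => [|x xs IH] s sxs cs.
  by case: s sxs {cs} => // y s /(_ y (mem_head _ _)).
rewrite -(count_predC (pred1 x)) /= mulSn leq_add ?cs ?mem_head //.
rewrite -size_filter; apply: IH => [y|y yxs].
  by rewrite mem_filter /= => /andP[yx /sxs]; rewrite inE (negbTE yx).
apply: leq_trans (cs y _); last by rewrite inE yxs orbT.
by rewrite count_filter; apply: sub_count => z /= /andP[].
Qed.

(* Moving the occurrences of x to the left conjugates the letters they cross. *)
Lemma prodg_collect (G : groupType) (S : set G) (x : G) (k : nat) (s : seq G) :
  (forall y g, S y -> S (y ^ g)) -> (forall y, y \in s -> S y) ->
  k <= count_mem x s ->
  exists s' : seq G, [/\ (forall y, y \in s' -> S y), (k + size s' = size s)%N &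
    \prod_(y <- s) y = x ^+ k * \prod_(y <- s') y].
Proof.
move=> SJ; elim: s k => [|y s IH] k Ss ks.
  by exists [::]; move: ks; rewrite leqn0 => /eqP ->; rewrite mul1g.
have Sy : S y by apply: Ss; rewrite mem_head.
have {}Ss z : z \in s -> S z by move=> zs; apply: Ss; rewrite inE zs orbT.
case: k ks => [_|k].
  by exists (y :: s); rewrite mul1g; split=> // z /predU1P[->|/Ss].
rewrite /= big_cons; case: eqVneq => [->|_] ks.
  have [s' [Ss' <- ->]] := IH k Ss ks.
  by exists s'; rewrite expgS mulgA; split.
have [s' [Ss' szs ->]] := IH k.+1 Ss ks.
exists (y ^ (x ^+ k.+1) :: s'); split.
- by move=> z /predU1P[->|/Ss' //]; apply: SJ.
- by rewrite /= addnS szs.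
by rewrite big_cons [RHS]mulgA -conjgC mulgA.
Qed.

(** * Finitely many gamma values generate a finite subgroup *)

Section Concise.
Context {G : groupType} (k : nat) (xs : seq G).
Implicit Types (a b c g t x y : G).
Local Notation X := (gamma_values G k.+2).
Hypothesis XE : X = [set` xs].

Let mem_xs x : X x -> x \in xs. Proof. by rewrite XE. Qed.
Let xs_mem x : x \in xs -> X x. Proof. by rewrite XE. Qed.

(* The centre of the centraliser of X: an abelian normal subgroup of G that
   contains a fixed power of every element of X. *)
Let A := [set a | (forall c, X c -> commute a c) /\
  forall p, (forall c, X c -> commute p c) -> commute a p].

Let A_comm a b : A a -> A b -> commute a b.
Proof. by move=> [_ aC] [bX _]; apply: aC. Qed.

Let A1 : A 1.
Proof. by split=> *; apply/commute_sym/commute1. Qed.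

Let AV a : A a -> A a^-1.
Proof. by move=> [aX aC]; split=> *; apply/commute_sym/commuteV/commute_sym; auto. Qed.

Let AM a b : A a -> A b -> A (a * b).
Proof.
by move=> [aX aC] [bX bC]; split=> *; apply/commute_sym/commuteM; apply/commute_sym; auto.
Qed.

Let commuteJ a b g : commute a (b ^ g^-1) -> commute (a ^ g) b.
Proof. by move=> ab; rewrite /commute -[b](conjgKV g) -!conjMg ab. Qed.

Let AJ a g : A a -> A (a ^ g).
Proof.
move=> [aX aC]; split=> [c Xc|p pX]; apply: commuteJ.
  exact/aX/gamma_valuesJ.
apply: aC => c Xc; apply: commuteJ; rewrite invgK.
exact/pX/gamma_valuesJ.
Qed.

Let AR a t : A a -> A [~ a, t].
Proof. by move=> Aa; apply: AM; [apply: AV | apply: AJ]. Qed.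

Let AX a e : A a -> A (a ^+ e).
Proof. by move=> Aa; elim: e => // e IH; rewrite expgS; apply: AM. Qed.

Let commM a b t : A a -> A b -> [~ a * b, t] = [~ a, t] * [~ b, t].
Proof.
move=> Aa Ab; have -> : [~ a * b, t] = [~ a, t] ^ b * [~ b, t] by free_group.
by congr (_ * _); apply/conjg_fixP/commgP/A_comm; [apply: AR|].
Qed.

Let commX a t e : A a -> [~ a ^+ e, t] = [~ a, t] ^+ e.
Proof.
move=> Aa; elim: e => [|e IH]; first by free_group.
by rewrite !expgS commM ?IH //; apply: AX.
Qed.

Let foldl_commX a ts e : A a -> foldl commg (a ^+ e) ts = foldl commg a ts ^+ e.
Proof.
by elim: ts a => //= t ts IH a Aa; rewrite commX // IH //; apply: AR.
Qed.

(* The trace on A of the upper central series of G. *)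
Fixpoint upper i : set G :=
  if i is i'.+1 then [set a | A a /\ forall t, upper i' [~ a, t]] else [set 1].

Let upper1 i : upper i 1.
Proof.
elim: i => //= i IH; split=> // t.
by have -> : [~ 1, t] = 1 :> G by free_group.
Qed.

Let upperM i a b : upper i a -> upper i b -> upper i (a * b).
Proof.
elim: i a b => [|i IH] a b /=; first by move=> -> ->; rewrite mulg1.
move=> [Aa Ua] [Ab Ub]; split=> [|t]; first exact: AM.
by rewrite commM //; apply: IH.
Qed.

Let upperV i a : upper i a -> upper i a^-1.
Proof.
elim: i a => [|i IH] a /=; first by move=> ->; rewrite invg1.
move=> [Aa Ua]; split=> [|t]; first exact: AV.
suff -> : [~ a^-1, t] = [~ a, t]^-1 by apply: IH.
by apply/esym/mulg1_eq; rewrite -commM ?mulgV //; [free_group | apply: AV].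
Qed.

Let upperJ i a g : upper i a -> upper i (a ^ g).
Proof.
elim: i a g => [|i IH] a g /=; first by move=> ->; rewrite conj1g.
move=> [Aa Ua]; split=> [|t]; first exact: AJ.
by have -> : [~ a ^ g, t] = [~ a, t ^ g^-1] ^ g by [free_group]; apply: IH.
Qed.

(** By linearity on A the hypothesis says that all i-fold commutators of a^e vanish. *)
Let upper_foldl i a e : A a ->
  (forall ts, size ts = i -> foldl commg a ts ^+ e = 1) -> upper i (a ^+ e).
Proof.
elim: i a => [|i IH] a Aa tor /=; first exact: (tor [::]).
split=> [|t]; first exact: AX.
rewrite commX //; apply: IH => [|ts sts]; first exact: AR.
by apply: (tor (t :: ts)); rewrite /= sts.
Qed.

Let q := (size xs)`!.

(** Conjugation by powers of x keeps c inside the finite set X, so a repetition yields a power of x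
    that centralises c. *)
Let expq_commute x c : X c -> commute (x ^+ q) c.
Proof.
move=> Xc; pose H := [set y | commute y c].
apply: (expg_fact_closed (H := H) (f := fun i => c ^ (x ^+ i))).
- exact/commute_sym/commute1.
- by move=> a b ac bc; apply/commute_sym/commuteM; apply/commute_sym.
- by move=> i; apply/mem_xs/gamma_valuesJ.
move=> i d; rewrite addnC expgnDr conjgM => /conjg_inj/esym/conjg_fixP.
by rewrite commg1_sym => /commgP.
Qed.

Let expq_A x : X x -> A (x ^+ q).
Proof.
move=> Xx; split=> [c|p pX]; first exact: expq_commute.
by apply/commute_sym/commuteX/pX.
Qed.

(* All powers of [a, t_1, ..., t_(k+1)] are gamma_values, by linearity on A. *)
Let commA_expq a ts : A a -> size ts = k.+1 -> foldl commg a ts ^+ q = 1.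
Proof.
move=> Aa sts; apply: (expg_fact_closed (H := [set 1])
  (f := fun i => foldl commg a ts ^+ i)) => //.
- by move=> x y -> ->; rewrite mulg1.
- move=> i; rewrite -foldl_commX //; apply: mem_xs.
  by rewrite -[k.+1]add0n -sts; apply: gamma_values_foldl; rewrite gamma_values1.
by move=> i d /eqP; rewrite expgnDr -{1}[_ ^+ i]mulg1 => /eqP/mulgI.
Qed.

Let words r := [set \prod_(x <- s) x | s in
  [set s : seq G | (forall x, x \in s -> X x) /\ size s <= r]].

Let finite_words r : finite_set (words r).
Proof.
elim: r => [|r IH].
  apply: sub_finite_set (finite_set1 1) => _ [s [_ s0] <-].
  by move: s0; rewrite leqn0 size_eq0 => /eqP ->; rewrite big_nil.
have : finite_set ([set 1] `|` [set x * y | x in X & y in words r]).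
  rewrite finite_setU; split; first exact: finite_set1.
  by apply: finite_image2 IH; rewrite XE; apply: finite_seq.
apply: sub_finite_set => _ [[|x s] [Xs szs] <-]; first by left; rewrite big_nil.
right; exists x; first by apply: Xs; rewrite mem_head.
exists (\prod_(y <- s) y); last by rewrite big_cons.
by exists s => //; split=> // y ys; apply: Xs; rewrite inE ys orbT.
Qed.

(* Schur's trick: for x = [y, t] with x^e central modulo upper i, one has
   x^(e+1) = x (x^t)^e = [y, t^2] (x^t)^(e-1) modulo upper i, so that a word of
   X containing e+1 equal letters can be shortened. *)
Let shorten i e (s : seq G) : 0 < e -> (forall x, X x -> upper i.+1 (x ^+ e)) ->
  (forall x, x \in s -> X x) ->
  exists2 w, words (size xs * e) w & upper i (w^-1 * \prod_(x <- s) x).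
Proof.
move=> e_gt0 expe; have [n] := ubnP (size s); elim: n s => // n IH s.
rewrite ltnS => szs Xs; case: (leqP (size s) (size xs * e)) => [les|].
  by exists (\prod_(x <- s) x); [exists s | rewrite mulVg].
move=> lts; have [x xxs cx] : exists2 x, x \in xs & e.+1 <= count_mem x s.
  apply: contrapT => nx; move: lts; rewrite ltnNge size_le_count //.
    by move=> y /Xs /mem_xs.
  by move=> x xxs; rewrite leqNgt; apply/negP => cx; apply: nx; exists x.
have Xx := xs_mem xxs.
have [s' [Xs' szs' ->]] := prodg_collect (fun y g => @gamma_valuesJ _ _ y g) Xs cx.
move: (Xx); rewrite gamma_valuesS => -[y Xy [t _ ytx]].
(* This word has 1 + (e - 1) + |s'| letters, one fewer than s. *)
pose s1 := [~ y, t * t] :: nseq e.-1 (x ^ t) ++ s'.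
have [||w Ww Uw] := IH s1.
- by rewrite /= size_cat size_nseq; lia.
- move=> z; rewrite inE mem_cat mem_nseq => /or3P[/eqP ->|/andP[_ /eqP ->]|/Xs' //].
    exact: gamma_values_commg.
  exact: gamma_valuesJ.
exists w => //.
(* Replacing x^e by (x^e)^t costs a conjugate of [x^e, t]^-1, which lies in [upper i] since x^e lies
   in [upper i.+1]. *)
have -> : w^-1 * (x ^+ e.+1 * \prod_(y <- s') y) =
    (w^-1 * \prod_(x <- s1) x) *
    ([~ x ^+ e, t]^-1) ^ (\prod_(y <- s') y).
  rewrite big_cons big_cat /= big_nseq.
  have -> : [~ y, t * t] = x * x ^ t by rewrite -ytx; free_group.
  have -> : iter e.-1 (mul (x ^ t)) 1 = (x ^ t) ^+ e.-1.
    by elim: (e.-1) => //= j ->; rewrite expgS.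
  have -> : x * x ^ t * ((x ^ t) ^+ e.-1 * \prod_(y <- s') y) =
      x * ((x ^+ e) ^ t * \prod_(y <- s') y).
    by rewrite -mulgA [x ^ t * _]mulgA -expgS prednK // conjXg.
  by rewrite expgS; move: (\prod_(y <- s') y) (x ^+ e) => p z; free_group.
apply: upperM => //; apply/upperJ/upperV.
by have [_] := expe x Xx; apply.
Qed.

(** Descent along [upper]: an exponent for X modulo one level leaves finitely many short words
    modulo the next level down, and a repetition among the powers of x then gives an exponent there.
    At level 0 the short words exhaust the subgroup. *)
Lemma finite_generated_words : finite_set (generated X).
Proof.
have genw i e : 0 < e -> (forall x, X x -> upper i.+1 (x ^+ e)) ->
    forall g, generated X g ->
    exists2 w, words (size xs * e) w & upper i (w^-1 * g).
  move=> e_gt0 expe g /generated_prod[|s Xs ->]; first exact: gamma_valuesV.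
  exact: shorten.
have descend i : i <= k.+1 ->
    exists2 e, 0 < e & forall x, X x -> upper (k.+1 - i) (x ^+ e).
  elim: i => [_|i IH /[dup] ik /ltnW/IH[e e_gt0 expe]].
    (* The first factor q brings x into A; the second kills all (k + 1)-fold commutators there. *)
    exists (q * q)%N; first by rewrite muln_gt0 fact_gt0.
    move=> x Xx; rewrite subn0 expgnA; apply: upper_foldl (expq_A Xx) _.
    by move=> ts; apply: commA_expq; apply: expq_A.
  rewrite -(subnSK ik) in expe.
  have /finite_seqP[ws wsE] := finite_words (size xs * e).
  exists (size ws)`!; first exact: fact_gt0.
  move=> x Xx; have gx j : generated X (x ^+ j).
    by apply: generatedX; apply: sub_generated.
  have wP j : exists w, w \in ws /\ upper (k.+1 - i.+1) (w^-1 * x ^+ j).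
    have [w Ww Uw] := genw _ _ e_gt0 expe _ (gx j).
    by exists w; split=> //; move: Ww; rewrite wsE.
  have [f fP] := choice wP.
  apply: (expg_fact_closed (f := f)) => [|a b|j|j d fj]; first exact: upper1.
  - exact: upperM.
  - by have [] := fP j.
  have [_ U1] := fP j; have [_] := fP (j + d)%N; rewrite -fj => U2.
  have -> : x ^+ d = ((f j)^-1 * x ^+ j)^-1 * ((f j)^-1 * x ^+ (j + d)).
    by rewrite expgnDr; free_group.
  by apply: upperM U2; apply: upperV.
have [e e_gt0 expe] := descend k.+1 (leqnn _); rewrite subnn in expe.
apply: sub_finite_set (finite_words (size xs * e)) => g gg.
have [|w Ww /= Uw] := genw 0%N e e_gt0 _ g gg.
  by move=> x Xx /=; rewrite (expe x Xx); split=> // t; free_group.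
by rewrite -[g](mulVKg w) Uw mulg1.
Qed.

End Concise.

Lemma finite_generated_gamma (G : groupType) k :
  finite_set (gamma_values G k.+2) ->
  finite_set (generated (gamma_values G k.+2)).
Proof. by move=> /finite_seqP[xs]; apply: finite_generated_words. Qed.

(** * Lower central subgroups and quotients *)

Lemma lower_central_gamma (G : groupType) (i : nat) :
  gamma_values G i.+1 `<=` lower_central G i /\
  lower_central G i `<=` generated (gamma_values G i.+1).
Proof.
elim: i => [|i [subl subr]].
  by rewrite gamma_values1; split=> // x _; apply: sub_generated.
split=> [x|].
  rewrite gamma_valuesS => -[y /subl Ly [t _ <-]].
  by apply: sub_generated; exists y => //; exists t.
apply: generated_sub; first exact: generated_group.
move=> _ [x /subr Gx [t _ <-]].
(* H is a subgroup because the subgroup generated by the values of weight i + 2 is normal. *)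
pose H := [set h | forall t, generated (gamma_values G i.+2) [~ h, t]].
suff : generated (gamma_values G i.+1) `<=` H by apply.
have GJ h g : generated (gamma_values G i.+2) h ->
    generated (gamma_values G i.+2) (h ^ g).
  by apply: generatedJ => y; apply: gamma_valuesJ.
apply: generated_sub => [|y Xy s]; last first.
  by apply: sub_generated; apply: gamma_values_commg.
have [/set_mem g1 gF] := generated_group (gamma_values G i.+2).
apply: group_closedP => [s|y z Hy Hz s].
  by have -> : [~ 1, s] = 1 :> G by free_group.
have -> : [~ y * z^-1, s] = ([~ y, s] * [~ z, s]^-1) ^ z^-1.
  by rewrite /commg /conjg; free_group.
by apply: GJ; apply/set_mem/gF; apply/mem_set.
Qed.

Section Quotients.
Local Open Scope quotient_scope.
Context {G : groupType}.

Lemma gamma_values_quotient (N : normal_subgroup G) (n : nat) :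
  gamma_values (quotient_group N) n.+1 =
  \pi_(quotient_group N) @` gamma_values G n.+1.
Proof.
elim: n => [|n IH].
  rewrite !gamma_values1; apply/seteqP; split=> // x _.
  by exists (repr x) => //; rewrite reprK.
have piR x t : \pi_(quotient_group N) [~ x, t] =
    [~ \pi_(quotient_group N) x, \pi_(quotient_group N) t].
  by rewrite /commg /conjg !pi_quotientM !pi_quotientV.
rewrite !gamma_valuesS IH; apply/seteqP; split.
  move=> _ [_ [x Xx <-] [t _ <-]]; exists [~ x, repr t].
    by exists x => //; exists (repr t).
  by rewrite piR reprK.
move=> _ [_ [x Xx [t _ <-]] <-]; exists (\pi_(quotient_group N) x).
  by exists x.
by exists (\pi_(quotient_group N) t) => //; rewrite piR.
Qed.

Lemma pi_quotient_eq1 (N : normal_subgroup G) (x : G) :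
  \pi_(quotient_group N) x = 1 <-> normal_set N x.
Proof.
rewrite -pi_quotient1; split=> [/eq_quotientP|Nx].
  by rewrite mulg1 => /normal_setV; rewrite invgK.
by apply/eq_quotientP; rewrite mulg1; apply: normal_setV.
Qed.

(** Gamma values that vanish in G/N lie in the finite N. Conversely the subgroup generated by
    finitely many gamma values is finite and serves as N. *)
Lemma finite_by_nilpotentP :
  finite_by_nilpotent G <-> exists n, finite_set (gamma_values G n.+2).
Proof.
split=> [[N [finN [c nil]]]|[n /finite_generated_gamma finX]].
  exists c; apply: sub_finite_set finN => x Xx; apply/pi_quotient_eq1.
  suff : lower_central (quotient_group N) c (\pi_(quotient_group N) x).
    by rewrite nil.
  apply: (lower_central_gamma (quotient_group N) c).1.
  rewrite gamma_values_quotient; exists x => //.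
  by apply: (@gamma_values_antimono _ _ 1); rewrite addn1.
have XJ x g : generated (gamma_values G n.+2) x ->
    generated (gamma_values G n.+2) (x ^ g).
  by apply: generatedJ => y; apply: gamma_valuesJ.
pose N := NormalSubgroup (generated_group (gamma_values G n.+2)) XJ.
exists N; split => //; exists n.+1.
have [sub1 sub2] := lower_central_gamma (quotient_group N) n.+1.
apply/seteqP; split=> [x /sub2|_ ->]; last first.
  exact: sub1 (@gamma_value_one (quotient_group N) n.+1).
apply: (generated_sub (H := [set 1])).
  by apply: group_closedP => // y z -> ->; rewrite mulgV.
rewrite gamma_values_quotient => _ [y Xy <-].
by apply/pi_quotient_eq1; apply: sub_generated.
Qed.

End Quotients.

Theorem theorem1p4 (G : groupType) :
  finite_by_nilpotent G <->
  exists m n : nat, [/\ (0 < m)%N, (0 < n)%N &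
    forall x : G, conj_set x (gamma_values G n) #<= `I_m].
Proof.
split=> [/finite_by_nilpotentP[n /finite_set_leP[m Xm]]|].
  (* The orbit is an image of the finite set of gamma values; the successor makes the bound
     positive. *)
  exists m.+1, n.+2; split=> // x.
  apply: card_le_trans (card_image_le _ _) (card_le_trans Xm _).
  by rewrite card_le_II.
move=> [m [[|n] [_ // _ boundX]]].
have finX a : finite_set (conj_set a (gamma_values G n.+1)).
  exact: card_le_finite (boundX a) (finite_II m).
have finR := finite_commutators boundX (fun y _ => finX y).
(* The given weight is now n + 1, and 2(n + 1) - 1 is [(n + n).+1]. This is the case j = 0, d = n,
   where the conjugating elements fill G. *)
have finJ z : gamma_values G (n + n).+1 z -> finite_set (conj_set z [set: G]).
  by rewrite -gamma_values1; apply: finite_conj_gamma.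
have bound2 a : conj_set a (gamma_values G (n + n).+1) #<= `I_m.
  apply: card_le_trans (boundX a); apply: subset_card_le.
  exact/image_subset/gamma_values_antimono.
apply/finite_by_nilpotentP; exists (n + n)%N.
apply: sub_finite_set (finite_image (fun x => x^-1) (finite_commutators bound2 finJ)).
rewrite gamma_valuesS => _ [y Xy [t _ <-]].
by exists [~ t, y]; [exists t => //; exists y | rewrite invgR].
Qed.
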